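(* Let $D$ be a database and let $\Sigma$ be a finite set of linear TGDs. Then: (1) $\Sigma\in\mathsf{CT}_D$ if and only if $\mathsf{simple}(\Sigma)\in\mathsf{CT}_{\mathsf{simple}(D)}$; that is, $\mathsf{chase}(D,\Sigma)$ is finite if and only if $\mathsf{chase}(\mathsf{simple}(D),\mathsf{simple}(\Sigma))$ is finite. (2) $\mathsf{maxdepth}(D,\Sigma)=\mathsf{maxdepth}(\mathsf{simple}(D),\mathsf{simple}(\Sigma))$.
   Context: **Basics.** $\mathbf{C},\mathbf{N},\mathbf{V}$ are disjoint countably infinite sets of constants, nulls and variables; their elements are terms. A schema is a finite set of predicates, each with an arity $>0$. An atom is $R(\bar t)$ with $\bar t$ a tuple of terms of length the arity of $R$; a fact is an atom with only constants. An instance is a (possibly infinite) set of atoms over constants and nulls; a database is a finite set of facts; $\mathsf{dom}(I)$ is the set of terms occurring in $I$. A homomorphism from a set of atoms $A$ to a set of atoms $B$ maps terms of $A$ to terms of $B$, is the identity on $\mathbf{C}$, and maps atoms of $A$ to atoms of $B$. **TGDs.** A TGD $\sigma$ is a constant-free sentence $\forall\bar x\forall\bar y(\phi(\bar x,\bar y)\to\exists\bar z\,\psi(\bar x,\bar z))$ with $\phi$ (the body) and $\psi$ (the head) non-empty conjunctions of atoms over the variables $\bar x\cup\bar y$ and $\bar x\cup\bar z$; conjunctions are identified with sets of atoms. The frontier $\mathsf{fr}(\sigma)$ is the set of variables $\bar x$ occurring in both body and head. A TGD is linear if its body is a single atom; it is simple linear if moreover no variable occurs more than once in that atom. No two TGDs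 of a set share a variable (w.l.o.g.). **Semi-oblivious chase.** A trigger for $\Sigma$ on an instance $I$ is $(\sigma,h)$ with $\sigma\in\Sigma$ and $h$ a homomorphism from $\mathsf{body}(\sigma)$ to $I$. Its result $\mathsf{result}(\sigma,h)$ is $\mu(\mathsf{head}(\sigma))$, where $\mu(x)=h(x)$ if $x\in\mathsf{fr}(\sigma)$ and otherwise $\mu(x)$ is the null $\bot^x_{\sigma,h_{|\mathsf{fr}(\sigma)}}$, uniquely determined by $x$, $\sigma$ and the restriction of $h$ to $\mathsf{fr}(\sigma)$. The trigger is active if $\mathsf{result}(\sigma,h)\not\subseteq I$; applying it yields $I\cup\mathsf{result}(\sigma,h)$. A valid chase derivation of $D$ w.r.t. $\Sigma$ is a sequence of instances starting with $D$, each next one obtained by applying an active trigger, that is either finite with no active trigger on the last instance, or infinite and fair (every trigger active on some $I_i$ is not active on some later $I_j$). Its result is the union of its instances; all valid derivations have the same result, denoted $\mathsf{chase}(D,\Sigma)$. $\mathsf{CT}_D$ is the class of sets $\Sigma$ of TGDs such that $\mathsf{chase}(D,\Sigma)$ is finite. **Depth.** For $t\in\mathsf{dom}(\mathsf{chase}(D,\Sigma))$: $\mathsf{depth}(t)=0$ if $t$ is a constant, and $\mathsf{depth}(\bot^z_{\sigma,h})=1+\max(\{\mathsf{depth}(h(x))\mid x\in\mathsf{fr}(\sigma)\}\cup\{0\})$. $\mathsf{maxdepth}(D,\Sigma)$ is the maximum depth of terms in $\mathsf{dom}(\mathsf{chase}(D,\Sigma))$, and is $\infty$ if $\mathsf{chase}(D,\Sigma)$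 is infinite. **Simplification.** For a tuple of terms $\bar t=(t_1,\ldots,t_n)$, $\mathsf{unique}(\bar t)$ is obtained by keeping only the first occurrence of each term; $\mathsf{id}_{\bar t}(t_i)$ is the position of $t_i$ in $\mathsf{unique}(\bar t)$, and $\mathsf{id}(\bar t)=(\mathsf{id}_{\bar t}(t_1),\ldots,\mathsf{id}_{\bar t}(t_n))$. (E.g. for $\bar t=(x,y,x,z,y)$: $\mathsf{unique}(\bar t)=(x,y,z)$, $\mathsf{id}(\bar t)=(1,2,1,3,2)$.) The simplification of an atom $R(\bar t)$ is $\mathsf{simple}(R(\bar t))=R_{\mathsf{id}(\bar t)}(\mathsf{unique}(\bar t))$, where each $R_{\mathsf{id}(\bar t)}$ is a new predicate; the simplification of a set (or conjunction) of atoms is taken atomwise, giving $\mathsf{simple}(D)$. A specialization of a tuple of variables $\bar x=(x_1,\ldots,x_n)$ is a function $f$ from the variables of $\bar x$ to the variables of $\bar x$ with $f(x_1)=x_1$ and $f(x_i)\in\{f(x_1),\ldots,f(x_{i-1}),x_i\}$ for $2\le i\le n$. For a linear TGD $\sigma=R(\bar x)\to\exists\bar z\,\psi(\bar y,\bar z)$ with $\bar y\subseteq\bar x$, and a specialization $f$ of $\bar x$, the simplification of $\sigma$ induced by $f$ is the simple linear TGD $\mathsf{simple}(R(f(\bar x)))\to\exists\bar z\,\mathsf{simple}(\psi(f(\bar y),\bar z))$. $\mathsf{simple}(\sigma)$ is the set of all of these over all specializations $f$ of $\bar x$, and $\mathsf{simple}(\Sigma)=\bigcup_{\sigma\in\Sigma}\mathsf{simple}(\sigma)$.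 *)

(* Defs.v *)
From mathcomp Require Import all_boot finmap.
From mathcomp Require Import boolp classical_sets functions cardinality fsbigop.

Set Implicit Arguments.
Unset Strict Implicit.
Unset Printing Implicit Defensive.

Local Open Scope fset_scope.
Local Open Scope classical_set_scope.

(* Constants, nulls and variables are kept disjoint by typing: facts are atoms
   over [const], the atoms of a TGD are atoms over [var] (so TGDs are
   constant-free), and instances consist of atoms over [term], that is, over
   constants and nulls. *)
Definition const : Type := nat.
Definition var : Type := nat.

Record schema := Schema {
  predicate :> finType;
  arity : predicate -> nat;
  arity_gt0 : forall R, 0 < arity R }.

Definition atom (S : schema) (T : Type) : Type := {R : S & (arity R).-tuple T}.

Definition atom_pred (S : schema) (T : Type) (a : atom S T) : S := tag a.

Definition atom_args (S : schema) (T : Type) (a : atom S T) :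
  (arity (atom_pred a)).-tuple T := tagged a.

Definition map_atom (S : schema) (T U : Type) (f : T -> U) (a : atom S T) :
  atom S U :=
  Tagged (fun R : S => (arity R).-tuple U) (map_tuple f (atom_args a)).

Definition database (S : schema) : Type := {fset atom S const}.

Definition atom_vars (S : schema) (a : atom S var) : {fset var} :=
  [fset x in (atom_args a : seq var)].

Definition vars (S : schema) (A : {fset atom S var}) : {fset var} :=
  (\bigcup_(a <- A) atom_vars a)%fset.

(* The quantifiers of the sentence are determined by body and head: the
   variables of the body are universal, the other ones existential. *)
Record tgd (S : schema) := Tgd {
  body : {fset atom S var};
  head : {fset atom S var};
  body_neq0 : body != fset0;
  head_neq0 : head != fset0 }.

Definition frontier (S : schema) (sigma : tgd S) : {fset var} :=
  (vars (body sigma) `&` vars (head sigma))%fset.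

Definition linear (S : schema) (sigma : tgd S) : Prop :=
  #|` body sigma| = 1.

(* [Null x sigma h] is the null named by the variable [x], the TGD [sigma] and
   the restriction [h] of a homomorphism to the frontier of [sigma]. *)
Inductive term (S : schema) : Type :=
| Const of const
| Null (x : var) (sigma : tgd S) of {ffun frontier sigma -> term S}.

Arguments Const {S} _.
Arguments Null {S} x sigma _.

Fixpoint depth (S : schema) (t : term S) : nat :=
  match t with
  | Const _ => 0
  | Null _ _ h => (\max_x depth (h x)).+1
  end.

Section Chase.
Context (S : schema).
Implicit Types (D : database S) (Sigma : set (tgd S)) (sigma : tgd S).

Definition instance : Type := set (atom S (term S)).

Implicit Types (I J : instance) (h : var -> term S).

Definition dom I : set (term S) :=
  [set t | exists2 a, I a & exists i, t = tnth (atom_args a) i].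

Definition instance_of D : instance :=
  [set map_atom Const a | a in [set` D]].

(* Homomorphisms from a body are given by assignments defined on all of [var];
   the values outside of the variables of the body play no role. *)
Definition trigger Sigma I sigma h : Prop :=
  Sigma sigma /\ forall a, a \in body sigma -> I (map_atom h a).

Definition result_subst sigma h (x : var) : term S :=
  if x \in frontier sigma then h x
  else Null x sigma [ffun y => h (val y)].

Definition result sigma h : instance :=
  [set map_atom (result_subst sigma h) a | a in [set` head sigma]].

Definition active Sigma I sigma h : Prop :=
  trigger Sigma I sigma h /\ ~ result sigma h `<=` I.

Definition chase_step Sigma I J : Prop :=
  exists sigma h, active Sigma I sigma h /\ J = I `|` result sigma h.

(* The derivation consists of [Is 0], ..., [Is n]. *)
Definition finite_derivation D Sigma (n : nat) (Is : nat -> instance) : Prop :=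
  [/\ Is 0 = instance_of D,
      forall i, i < n -> chase_step Sigma (Is i) (Is i.+1)
    & forall sigma h, ~ active Sigma (Is n) sigma h].

Definition infinite_derivation D Sigma (Is : nat -> instance) : Prop :=
  [/\ Is 0 = instance_of D,
      forall i, chase_step Sigma (Is i) (Is i.+1)
    & forall i sigma h, active Sigma (Is i) sigma h ->
        exists2 j, i < j & ~ active Sigma (Is j) sigma h].

Definition chase_result D Sigma J : Prop :=
  (exists n Is, finite_derivation D Sigma n Is /\
     J = (\bigcup_(i in [set i | i <= n]) Is i)) \/
  (exists Is, infinite_derivation D Sigma Is /\
     J = (\bigcup_i Is i)).

(* The result of the valid derivations, which does not depend on the
   derivation. *)
Definition chase D Sigma : instance := xget set0 (chase_result D Sigma).

Definition CT D : set (set (tgd S)) :=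
  [set Sigma | finite_set (chase D Sigma)].

(* [None] stands for infinity. The maximum over the empty domain, which only
   arises for the empty database, is 0. *)
Definition maxdepth D Sigma : option nat :=
  if `[< finite_set (chase D Sigma) >]
  then Some (\big[maxn/0]_(d \in @depth S @` dom (chase D Sigma)) d)
  else None.

End Chase.

(* [undup] keeps the last occurrence of each element, hence the reversals. *)
Definition unique (T : eqType) (s : seq T) : seq T := rev (undup (rev s)).

(* Positions in [unique t] are counted from 1. *)
Definition id_tuple (T : eqType) (n : nat) (t : n.-tuple T) :
  n.-tuple 'I_n.+1 :=
  map_tuple (fun x => inord (index x (unique t)).+1) t.

Lemma mem_unique (T : eqType) (s : seq T) : unique s =i s.
Proof. by move=> x; rewrite mem_rev mem_undup mem_rev. Qed.

Lemma uniq_unique (T : eqType) (s : seq T) : uniq (unique s).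
Proof. by rewrite rev_uniq undup_uniq. Qed.

Lemma size_unique (T : eqType) (s : seq T) : size (unique s) <= size s.
Proof. by rewrite size_rev -(size_rev s) size_undup. Qed.

Lemma size_unique_id (T : eqType) (n : nat) (t : n.-tuple T) :
  size (unique t) == size (undup (id_tuple t)).
Proof.
have lt_id x : x \in unique t -> (index x (unique t)).+1 < n.+1.
  rewrite ltnS -index_mem => /leq_trans; apply.
  by rewrite -[leqRHS](size_tuple t) size_unique.
rewrite -(size_map (fun x => inord (index x (unique t)).+1 : 'I_n.+1)).
apply/eqP/perm_size/uniq_perm; rewrite ?undup_uniq //.
- rewrite map_inj_in_uniq ?uniq_unique // => x y xt yt /(congr1 val).
  by rewrite /= !inordK ?lt_id // => -[]; apply: index_inj.
- by move=> i; rewrite mem_undup; apply: eq_mem_map; apply: mem_unique.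
Qed.

(* The predicate [R_l] is encoded as the pair of [R] and [l]; its arity is the
   number of distinct entries of [l]. Those tuples [l] which are not of the form
   [id_tuple t] do not occur in any simplification. *)
Section SimpleSchema.
Context (S : schema).

Definition simple_pred : finType := {R : S & (arity R).-tuple 'I_(arity R).+1}.

Definition simple_arity (p : simple_pred) : nat := size (undup (tagged p)).

Lemma simple_arity_gt0 (p : simple_pred) : 0 < simple_arity p.
Proof.
rewrite /simple_arity -has_predT; apply/hasP.
by exists (tnth (tagged p) (Ordinal (arity_gt0 (tag p)))) => //;
  rewrite mem_undup mem_tnth.
Qed.

Definition simple_schema : schema := Schema simple_arity_gt0.

Definition simple_atom (T : eqType) (a : atom S T) : atom simple_schema T :=
  Tagged (fun p : simple_schema => (arity p).-tuple T)
    (Tuple (size_unique_id (atom_args a)) :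
       (@arity simple_schema
          (Tagged (fun R : S => (arity R).-tuple 'I_(arity R).+1)
             (id_tuple (atom_args a)))).-tuple T).

Definition simple_db (D : database S) : database simple_schema :=
  [fset simple_atom a | a in D].

(* Functions from the variables of [xs] to the variables of [xs] are extended by
   the identity to all variables. *)
Definition specialization (xs : seq var) (f : var -> var) : Prop :=
  (forall y, y \notin xs -> f y = y) /\
  forall i, i < size xs ->
    f (nth 0 xs i) \in nth 0 xs i :: [seq f x | x <- take i xs].

Definition simple_conj (f : var -> var) (A : {fset atom S var}) :
  {fset atom simple_schema var} :=
  [fset simple_atom (map_atom f a) | a in A].

Lemma simple_conj_neq0 (f : var -> var) (A : {fset atom S var}) :
  A != fset0 -> simple_conj f A != fset0.
Proof.
case/fset0Pn=> a aA; apply/fset0Pn.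
by exists (simple_atom (map_atom f a)); apply: in_imfset.
Qed.

Definition simple_tgd (f : var -> var) (sigma : tgd S) : tgd simple_schema :=
  Tgd (simple_conj_neq0 f (body_neq0 sigma))
      (simple_conj_neq0 f (head_neq0 sigma)).

Definition simple_tgds (sigma : tgd S) : set (tgd simple_schema) :=
  [set tau | exists a f, [/\ body sigma = [fset a],
     specialization (atom_args a) f & tau = simple_tgd f sigma]].

Definition simple_set (Sigma : set (tgd S)) : set (tgd simple_schema) :=
  \bigcup_(sigma in Sigma) simple_tgds sigma.

End SimpleSchema.

(* Main.v *)
(* The chase is the least set of atoms containing the database and closed under
   results of triggers; it is infinite exactly when the depths of its terms are
   unbounded, since only finitely many terms have a given depth. Hence it is
   enough to match the chases of (D, Sigma) and (simple D, simple Sigma) atom by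
   atom, up to a depth-preserving relation between terms: a trigger [h] of a
   linear TGD corresponds to the specialization [f] that identifies the same
   variables as [h]. The matching survives an application because a null of the
   head is deeper than all frontier values, so that it never coincides with one
   of them, and the equality type of a head atom is that of its image under [f]. *)
Require Import Defs.
From HB Require Import structures.
From mathcomp Require Import all_boot finmap.
From mathcomp Require Import boolp classical_sets functions cardinality fsbigop.
Import Defs.

Set Implicit Arguments.
Unset Strict Implicit.
Unset Printing Implicit Defensive.

Local Open Scope classical_set_scope.

(** * Finiteness of sets of functions *)

Lemma finite_set_range (U : Type) (A : set U) :
  finite_set A -> exists n (F : 'I_n -> U), A `<=` range F.
Proof.
move=> /finite_setP[n]; case: (pselect (A !=set0)) => [[u0 Au0]|A0] cA; last first.
  have x0 (i : 'I_0) : U by case: i.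
  by exists 0, x0 => u Au; case: A0; exists u.
(* The element [u0] makes [U] a pointed type, as the bijection lemma requires. *)
pose UP := HB.pack_for pointedType U (isPointed.Build U u0)
  (gen_eqMixin U) (gen_choiceMixin U).
have [f [_ _ surjf]] := (@card_set_bijP _ UP `I_n A) (card_esym cA).
exists n, (fun i => f (val i)) => u /surjf[i lin <-].
by exists (Ordinal lin).
Qed.

Lemma finite_ffun (T : finType) (U : Type) (A : set U) :
  finite_set A -> finite_set [set g : {ffun T -> U} | forall x, A (g x)].
Proof.
move=> /finite_set_range[n [F AF]].
have := @finite_image {ffun T -> 'I_n} _ setT (fun k => [ffun x => F (k x)]).
move=> /(_ finite_finset); apply: sub_finite_set => g Ag.
have /choice[k kP] : forall x, exists i, F i = g x.
  by move=> x; have [i _ <-] := AF _ (Ag x); exists i.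
by exists [ffun x => k x] => //; apply/ffunP => x; rewrite !ffunE kP.
Qed.

(** * The chase as a least fixpoint *)

Section Chase.
Context (S : schema).
Implicit Types (D : database S) (Sigma : set (tgd S)) (sigma : tgd S).
Implicit Types (I J : instance S) (h : var -> term S).

Lemma varsP (A : {fset atom S var}) x :
  reflect (exists2 a, a \in A & x \in atom_args a) (x \in vars A).
Proof.
apply: (iffP idP) => [/bigfcupP[a]|[a aA xa]].
  by rewrite andbT inE => aA xa; exists a.
by apply/bigfcupP; exists a; rewrite ?andbT // inE.
Qed.

Lemma eq_map_atom (T : eqType) U (f g : T -> U) (a : atom S T) :
  {in atom_args a, f =1 g} -> map_atom f a = map_atom g a.
Proof.
move=> fg; congr Tagged; apply: eq_from_tnth => i; rewrite !tnth_map.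
by apply: fg; rewrite mem_tnth.
Qed.

Lemma map_atom_comp (T U V : Type) (f : U -> V) (g : T -> U) (a : atom S T) :
  map_atom f (map_atom g a) = map_atom (f \o g) a.
Proof.
by congr Tagged; apply: eq_from_tnth => i; rewrite !tnth_map.
Qed.

(** Triggers fire regardless of activity, since an inactive one adds nothing. The inductive form
    gives an induction on the atoms of the chase that fixes no derivation. *)
Inductive derived D Sigma : atom S (term S) -> Prop :=
| derived_db a of a \in D : derived D Sigma (map_atom Const a)
| derived_result sigma h b of Sigma sigma
    & (forall a, a \in body sigma -> derived D Sigma (map_atom h a))
    & b \in head sigma :
    derived D Sigma (map_atom (result_subst sigma h) b).

Lemma derived_closed D Sigma sigma h :
  trigger Sigma (derived D Sigma) sigma h ->
  result sigma h `<=` derived D Sigma.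
Proof. by case=> Ss hb _ [b bh <-]; apply: derived_result. Qed.

Lemma derived_least D Sigma J : instance_of D `<=` J ->
  (forall sigma h, ~ active Sigma J sigma h) -> derived D Sigma `<=` J.
Proof.
move=> DJ nact b; elim=> [a aD|sigma h {}b Ss _ IH bh]; first by apply: DJ; exists a.
apply: contrapT => nJ; apply: (nact sigma h); split => // sub.
by apply/nJ/sub; exists b.
Qed.

Lemma subset_trigger Sigma I J sigma h :
  I `<=` J -> trigger Sigma I sigma h -> trigger Sigma J sigma h.
Proof. by move=> IJ [Ss hI]; split => // a /hI/IJ. Qed.

(** A body is finite, so the latest of the stages at which its atoms appear contains all of them. *)
Lemma chain_trigger Sigma (Is : nat -> instance S) sigma h :
  (forall i j, i <= j -> Is i `<=` Is j) ->
  trigger Sigma (\bigcup_i Is i) sigma h -> exists i, trigger Sigma (Is i) sigma h.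
Proof.
move=> mono [Ss hI].
have /choice[k kP] : forall a, exists i, a \in body sigma -> Is i (map_atom h a).
  move=> a; case: (boolP (a \in body sigma)) => [/hI[i _ Ii]|_]; last by exists 0.
  by exists i.
exists (\max_(a <- body sigma) k a); split => // a ab.
by apply: (mono (k a)); [exact: leq_bigmax_seq | exact: kP].
Qed.

Lemma steps_mono Sigma (Is : nat -> instance S) n :
  (forall i, i < n -> chase_step Sigma (Is i) (Is i.+1)) ->
  forall i j, i <= j -> j <= n -> Is i `<=` Is j.
Proof.
move=> step i j /subnKC <-; elim: (j - i) => [|k IH] lekn; first by rewrite addn0.
apply: subset_trans (IH _) _; first by rewrite ltnW // -addnS.
by rewrite addnS; have [|sigma [h [_ ->]] b] := step (i + k); [rewrite -addnS|left].
Qed.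

Lemma step_derived D Sigma I J :
  I `<=` derived D Sigma -> chase_step Sigma I J -> J `<=` derived D Sigma.
Proof.
move=> ID [sigma [h [[trg _] ->]]] b [/ID//|].
exact/derived_closed/(subset_trigger ID).
Qed.

Lemma instance_of_derived D Sigma : instance_of D `<=` derived D Sigma.
Proof. by move=> _ [a aD <-]; apply: derived_db. Qed.

(** Every stage stays inside the fixpoint by induction. Conversely, no trigger is active on the
    union: a finite derivation ends in it, and in an infinite one a trigger on the union lives on
    some stage and fairness puts its result into a later one. *)
Lemma chase_result_derived D Sigma J :
  chase_result D Sigma J -> J = derived D Sigma.
Proof.
case=> [[n [Is [[I0 step nact] ->]]]|[Is [[I0 step fair] ->]]].
  have mono := steps_mono step.
  apply/seteqP; split => [b [i /= lin Ib]|].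
    have: forall i, i <= n -> Is i `<=` derived D Sigma.
      elim=> [_|k IH lkn]; first by rewrite I0; apply: instance_of_derived.
      exact: step_derived (IH (ltnW lkn)) (step _ lkn).
    by move=> /(_ i lin); apply.
  suff -> : \bigcup_(i in [set i | i <= n]) Is i = Is n.
    by apply: derived_least => //; rewrite -I0; apply: mono.
  by apply/seteqP; split => [b [i lin]|b ?]; [exact: mono | exists n => /=].
have mono i j : i <= j -> Is i `<=` Is j.
  by move=> ij; apply: (@steps_mono Sigma Is j) => // k _; apply: step.
apply/seteqP; split => [b [i _]|].
  suff: forall i, Is i `<=` derived D Sigma by apply.
  elim=> [|k IH]; first by rewrite I0; apply: instance_of_derived.
  exact: step_derived IH (step k).
apply: derived_least => [|sigma h [trg nsub]].
  by rewrite -I0 => b ?; exists 0.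
have [i trgi] := chain_trigger mono trg.
have nacti : active Sigma (Is i) sigma h.
  by split => // sub; apply: nsub => b /sub ?; exists i.
have [j ij nact] := fair _ _ _ nacti; apply: nsub => b rb; exists j => //.
(* The trigger persists on [Is j], so if it is not active there, its result is contained in
   [Is j]. *)
apply: contrapT => nIb; apply: nact; split; last by move=> /(_ b rb).
by apply: subset_trigger trgi; apply/mono/ltnW.
Qed.

(** * Existence of a valid derivation *)

Lemma finite_dom I : finite_set I -> finite_set (dom I).
Proof.
move=> finI.
have: finite_set (\bigcup_(a in I) range (tnth (atom_args a))).
  apply: bigcup_finite => // a _; apply: finite_image; exact: finite_finset.
apply: sub_finite_set => t [a Ia [i ->]]; exists a => //; by exists i.
Qed.

(** An assignment [h] ranges over infinitely many variables, but a result depends only on its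
    frontier restriction [g], and over a finite instance there are finitely many of these. *)
Definition frontier_subst sigma (g : {ffun frontier sigma -> term S}) x : term S :=
  if insub x is Some y then g y else Null x sigma g.

Lemma result_substE sigma h :
  result_subst sigma h = frontier_subst [ffun y : frontier sigma => h (val y)].
Proof.
apply: funext => x; rewrite /result_subst /frontier_subst.
by case: insubP => [y -> <-|/negPf -> //]; rewrite ffunE.
Qed.

Lemma finite_results Sigma I : finite_set Sigma -> finite_set I ->
  finite_set [set b | exists sigma h, trigger Sigma I sigma h /\ result sigma h b].
Proof.
move=> finS finI.
have: finite_set (\bigcup_(sigma in Sigma)
  \bigcup_(g in [set g : {ffun frontier sigma -> term S} | forall y, dom I (g y)])
    [set map_atom (frontier_subst g) a | a in [set` head sigma]]).
  apply: bigcup_finite => // sigma _; apply: bigcup_finite.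
    exact/finite_ffun/finite_dom.
  by move=> g _; apply/finite_image/finite_fset.
apply: sub_finite_set => b [sigma [h [[Ss hI] [a ah <-]]]].
exists sigma => //; exists [ffun y : frontier sigma => h (val y)].
  move=> y; rewrite ffunE; have := valP y; rewrite inE => /andP[/varsP[a' a'b]].
  move=> /tnthP[i ->] _; exists (map_atom h a'); first exact: hI.
  by exists i; rewrite tnth_map.
by exists a => //; rewrite result_substE.
Qed.

(** Parallel rounds: each fires all triggers on the previous one. For finite [Sigma] every round is
    finite, and the first round that carries a trigger serves as its priority. *)
Fixpoint level D Sigma k : instance S :=
  if k is k'.+1 then
    level D Sigma k' `|`
    [set b | exists sigma h, trigger Sigma (level D Sigma k') sigma h /\ result sigma h b]
  else instance_of D.

Lemma finite_level D Sigma k : finite_set Sigma -> finite_set (level D Sigma k).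
Proof.
move=> finS; elim: k => [|k IH] /=; first exact/finite_image/finite_fset.
by rewrite finite_setU; split => //; apply: finite_results.
Qed.

Lemma level_mono D Sigma i j : i <= j -> level D Sigma i `<=` level D Sigma j.
Proof.
move=> /subnKC <-; elim: (j - i) => [|k IH]; first by rewrite addn0.
by rewrite addnS => b /IH; left.
Qed.

Lemma level_result D Sigma k sigma h :
  trigger Sigma (level D Sigma k) sigma h -> result sigma h `<=` level D Sigma k.+1.
Proof. by move=> trg b rb; right; exists sigma, h. Qed.

(* Fairness is achieved by always applying an active trigger of least level. *)
Definition least_step D Sigma I J : Prop := exists sigma h k,
  [/\ active Sigma I sigma h, trigger Sigma (level D Sigma k) sigma h,
      J = I `|` result sigma h
    & forall sigma' h' k', active Sigma I sigma' h' ->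
        trigger Sigma (level D Sigma k') sigma' h' -> k <= k'].

Lemma ex_least_step D Sigma I :
  I `<=` \bigcup_k level D Sigma k -> (exists sigma h, active Sigma I sigma h) ->
  exists J, least_step D Sigma I J.
Proof.
move=> IL [sigma0 [h0 act0]].
pose P k := `[< exists sigma h,
  active Sigma I sigma h /\ trigger Sigma (level D Sigma k) sigma h >].
have exP : exists k, P k.
  have [k trgk] := chain_trigger (@level_mono D Sigma)
    (subset_trigger IL (proj1 act0)).
  by exists k; apply/asboolP; exists sigma0, h0.
case: (ex_minnP exP) => k /asboolP[sigma [h [act trg]]] kmin.
exists (I `|` result sigma h), sigma, h, k; split => // sigma' h' k' act' trg'.
by apply: kmin; apply/asboolP; exists sigma', h'.
Qed.

Lemma least_step_level D Sigma I J : I `<=` \bigcup_k level D Sigma k ->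
  least_step D Sigma I J -> J `<=` \bigcup_k level D Sigma k.
Proof.
move=> IL [sigma [h [k [_ trg -> _]]]] b [/IL//|/(level_result trg) ?].
by exists k.+1.
Qed.

(** Atoms once present stay present, so choosing a new atom at each stage would inject the naturals
    into [A]. *)
Lemma no_infinite_growth (A : instance S) (Is : nat -> instance S) : finite_set A ->
  (forall i j, i <= j -> Is i `<=` Is j) ->
  ~ forall i, exists b, [/\ A b, Is i.+1 b & ~ Is i b].
Proof.
move=> finA mono /choice[e eP]; apply: infinite_nat.
have injlt i j : i < j -> e i <> e j.
  move=> ij eq; have [_ _] := eP j; rewrite -eq; apply.
  by apply: (mono i.+1) => //; have [] := eP i.
have : finite_set (e @^-1` A).
  apply: finite_preimage => // i j _ _ eij.
  by case: (ltngtP i j) => // /injlt; rewrite eij.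
by apply: sub_finite_set => i _; have [] := eP i.
Qed.

(** [chase] is a choice with default [set0], so a valid derivation has to be exhibited. Least steps
    are iterated until no trigger is active, or forever. *)
Lemma ex_chase_result D Sigma : finite_set Sigma -> exists J, chase_result D Sigma J.
Proof.
move=> finS.
(* Where a premise fails the implication is vacuous, and [I] serves as a dummy value of [next]. *)
have /choice[next nextP] : forall I, exists J, I `<=` \bigcup_k level D Sigma k ->
    (exists sigma h, active Sigma I sigma h) -> least_step D Sigma I J.
  move=> I; case: (pselect (I `<=` \bigcup_k level D Sigma k)) => [IL|nIL]; last by exists I.
  case: (pselect (exists sigma h, active Sigma I sigma h)) => [act|nact]; last by exists I.
  by have [J] := ex_least_step IL act; exists J.
pose Is i := iter i next (instance_of D).
pose stuck i := `[< forall sigma h, ~ active Sigma (Is i) sigma h >].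
have actP i : ~~ stuck i -> exists sigma h, active Sigma (Is i) sigma h.
  by move=> /asboolPn/existsNP[sigma /existsNP[h /contrapT]]; exists sigma, h.
have lev i : (forall j, j < i -> ~~ stuck j) -> Is i `<=` \bigcup_k level D Sigma k.
  elim: i => [_|i IH nst]; first by move=> b Db; exists 0.
  have ILi : Is i `<=` \bigcup_k level D Sigma k by apply: IH => j /ltnW; apply: nst.
  exact: least_step_level ILi (nextP _ ILi (actP _ (nst i (leqnn _)))).
have step i : (forall j, j <= i -> ~~ stuck j) -> least_step D Sigma (Is i) (Is i.+1).
  by move=> nst; apply: nextP; [apply: lev => j /ltnW; apply: nst | exact/actP/nst].
have chstep I J : least_step D Sigma I J -> chase_step Sigma I J.
  by move=> [sigma [h [k [act _ -> _]]]]; exists sigma, h.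
case: (pselect (exists n, stuck n)) => [exst|nst].
  case: (ex_minnP exst) => n /asboolP stn nmin.
  exists (\bigcup_(i in [set i | i <= n]) Is i); left; exists n, Is; split => //.
  split => // i lin; apply/chstep/step => j lji.
  by apply/negP => /nmin; rewrite leqNgt (leq_ltn_trans lji).
have {}step i : least_step D Sigma (Is i) (Is i.+1).
  by apply: step => j _; apply/negP => stj; apply: nst; exists j.
have mono i j : i <= j -> Is i `<=` Is j.
  by move=> ij; apply: (@steps_mono Sigma Is j) => // k _; apply/chstep/step.
exists (\bigcup_i Is i); right; exists Is; split => //; split => //.
  by move=> i; apply/chstep/step.
move=> i sigma h act; apply: contrapT => nfair.
(* A violation of fairness keeps the trigger active at every stage from [i] on. *)
have {nfair} act' j : active Sigma (Is (i + j)) sigma h.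
  case: j => [|j]; first by rewrite addn0.
  by apply: contrapT => nact; apply: nfair; exists (i + j.+1) => //; rewrite addnS ltnS leq_addr.
have [k trgk] : exists k, trigger Sigma (level D Sigma k) sigma h.
  apply: chain_trigger (@level_mono D Sigma) _.
  have IL : Is i `<=` \bigcup_k level D Sigma k.
    by apply: lev => j _; apply/negP => stj; apply: nst; exists j.
  exact: subset_trigger IL (proj1 act).
(* While a trigger of level [k] stays active, each step fires one of level at most [k], and so adds
   a new atom of the finite set [level D Sigma k.+1]. *)
apply: (@no_infinite_growth (level D Sigma k.+1) (fun j => Is (i + j))).
- exact: finite_level.
- by move=> a b ab; apply: mono; rewrite leq_add2l.
- move=> j; rewrite addnS; have [s [g [l [[_ nsub] trgl -> lmin]]]] := step (i + j).
  have /existsNP[b /not_implyP[rb nIb]] := nsub; exists b; split => //; last by right.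
  apply: (@level_mono D Sigma l.+1); last exact: level_result rb.
  by rewrite ltnS; apply: lmin (act' j) trgk.
Qed.

Lemma chaseE D Sigma : finite_set Sigma -> chase D Sigma = derived D Sigma.
Proof.
move=> /(ex_chase_result D) [J cJ]; rewrite /chase.
by apply: chase_result_derived; case: xgetP => [? _ //|/(_ J)].
Qed.

End Chase.
(** * Finiteness of the chase and depth *)

Section Depth.
Context (S : schema).
Implicit Types (D : database S) (Sigma : set (tgd S)) (sigma : tgd S).
Implicit Types (I J : instance S) (h : var -> term S).

(** A finite set large enough to contain all terms of depth at most [k] that occur in the chase. *)
Fixpoint terms_upto D Sigma k : set (term S) :=
  dom (instance_of D) `|`
  if k is k'.+1 then
    [set t | exists sigma x (g : {ffun frontier sigma -> term S}),
       [/\ Sigma sigma, x \in vars (head sigma),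
       forall y : frontier sigma, terms_upto D Sigma k' (g y) & t = Null x sigma g]]
  else set0.

Lemma finite_instance_of D : finite_set (instance_of D).
Proof. exact/finite_image/finite_fset. Qed.

Lemma finite_terms_upto D Sigma k :
  finite_set Sigma -> finite_set (terms_upto D Sigma k).
Proof.
move=> finS; have finD := finite_dom (finite_instance_of D).
elim: k => [|k IH] /=; rewrite finite_setU; split=> //.
have: finite_set (\bigcup_(sigma in Sigma) \bigcup_(x in [set` vars (head sigma)])
  [set Null x sigma g | g in
     [set g : {ffun frontier sigma -> term S} | forall y, terms_upto D Sigma k (g y)]]).
  apply: bigcup_finite => // sigma _; apply: bigcup_finite; first exact: finite_fset.
  by move=> x _; apply/finite_image/finite_ffun.
apply: sub_finite_set => _ [sigma [x [g [Ss xh gk ->]]]].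
by exists sigma => //; exists x => //; exists g.
Qed.

Lemma terms_upto_mono D Sigma i j :
  i <= j -> terms_upto D Sigma i `<=` terms_upto D Sigma j.
Proof.
elim: i j => [|i IH] [|j] // ij t; try by case=> // ?; left.
case=> [?|[sigma [x [g [Ss xh gi ->]]]]]; [by left | right].
by exists sigma, x, g; split => // y; exact: IH ij _ (gi y).
Qed.

Lemma depth_frontier (x : var) sigma (g : {ffun frontier sigma -> term S}) y :
  depth (g y) < depth (Null x sigma g).
Proof. by rewrite /= ltnS (@leq_bigmax _ (fun y => depth (g y))). Qed.

Lemma frontier_body sigma y :
  y \in frontier sigma -> exists2 a, a \in body sigma & y \in atom_args a.
Proof. by rewrite inE => /andP[/varsP]. Qed.

(** Frontier values occur in the image of the body, where the induction hypothesis applies to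
    them. *)
Lemma derived_terms D Sigma b :
  derived D Sigma b -> forall i, let t := tnth (atom_args b) i in
    terms_upto D Sigma (depth t) t.
Proof.
elim=> {b} [a aD|sigma h b Ss _ IH bh] i /=.
  set t := tnth _ _; have: dom (instance_of D) t.
    by exists (map_atom Const a) => //; [exists a | exists i].
  by case: (depth t) => [|k]; left.
rewrite tnth_map /result_subst; case: ifP => yf.
  have [a ab /tnthP[j ->]] := frontier_body yf.
  by have := IH a ab j; rewrite tnth_map.
rewrite /=; right.
set g := [ffun _ => _]; exists sigma, (tnth (atom_args b) i), g; split => //.
  by apply/varsP; exists b => //; rewrite mem_tnth.
(* Each argument of the null lies at its own depth and is lifted to the maximum. *)
move=> y; apply: (@terms_upto_mono _ _ (depth (g y))).
  exact: (@leq_bigmax _ (fun y => depth (g y))).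
rewrite ffunE; have [a ab /tnthP[j ->]] := frontier_body (valP y).
by have := IH a ab j; rewrite tnth_map.
Qed.

Lemma finite_atoms (T : Type) (A : set T) : finite_set A ->
  finite_set [set a : atom S T | forall i, A (tnth (atom_args a) i)].
Proof.
move=> finA; have: finite_set (\bigcup_(R in [set: S])
  [set Tagged (fun R : S => (arity R).-tuple T) [tuple g i | i < arity R] | g in
     [set g : {ffun 'I_(arity R) -> T} | forall y, A (g y)]]).
  apply: bigcup_finite => [|R _]; first exact: finite_finset.
  exact/finite_image/finite_ffun.
apply: sub_finite_set => -[R t] /= At; exists R => //.
exists [ffun i => tnth t i]; first by move=> i; rewrite ffunE; apply: At.
by congr Tagged; apply: eq_from_tnth => i; rewrite tnth_mktuple ffunE.
Qed.

(** Bounded depth leaves finitely many terms, hence finitely many atoms over a finite schema.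
    Finiteness thus becomes a property of the set of depths alone. *)
Lemma finite_derivedP D Sigma : finite_set Sigma ->
  finite_set (derived D Sigma) <->
  exists k, forall d, (@depth S @` dom (derived D Sigma)) d -> d <= k.
Proof.
move=> finS; split=> [/finite_dom/(finite_image (@depth S))/finite_fsetP[A ->]|[k lek]].
  by exists (\max_(d <- A) d) => d dA; apply: leq_bigmax_seq.
have := finite_atoms (finite_terms_upto D k finS).
apply: sub_finite_set => b Hb i.
apply: terms_upto_mono (derived_terms Hb i); apply: lek.
by eexists; last by []; exists b => //; exists i.
Qed.

End Depth.

(** * Matching the two chases *)

Section Simplification.
Context (S : schema).

(** * Equality types of atoms *)

Lemma atom_eq (S' : schema) (T : Type) (a b : atom S' T) :
  tag a = tag b -> atom_args a = atom_args b :> seq T -> a = b.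
Proof.
case: a b => [R s] [R' t] /= eqR; case: R' / eqR t => t /= st.
by congr Tagged; apply: val_inj.
Qed.

Lemma map_atom_eq_in (S' : schema) (T : eqType) (U : Type) (f g : T -> U)
    (a : atom S' T) :
  map_atom f a = map_atom g a -> {in atom_args a, f =1 g}.
Proof.
case: a => R s e; have {}e : map_tuple f s = map_tuple g s := eq_from_Tagged e.
by apply/eq_in_map; apply: (congr1 (@tval _ _) e).
Qed.

Lemma undup_map_in (T U : eqType) (f : T -> U) (s : seq T) :
  {in s &, injective f} -> undup (map f s) = map f (undup s).
Proof.
elim: s => //= x s IH inj.
have injs : {in s &, injective f}.
  by move=> y z ys zs; apply: inj; rewrite inE ?ys ?zs orbT.
have -> : (f x \in map f s) = (x \in s).
  apply/mapP/idP => [[y ys fxy]|xs]; last by exists x.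
  by rewrite (inj x y) // inE ?eqxx // ys orbT.
by case: ifP => _ /=; rewrite IH.
Qed.

Lemma unique_map_in (T U : eqType) (f : T -> U) (s : seq T) :
  {in s &, injective f} -> unique (map f s) = map f (unique s).
Proof.
move=> inj; rewrite /unique -map_rev undup_map_in ?map_rev // => x y.
by rewrite !mem_rev; apply: inj.
Qed.

Lemma index_map_in (T U : eqType) (f : T -> U) (s : seq T) x :
  {in s &, injective f} -> x \in s -> index (f x) (map f s) = index x s.
Proof.
move=> inj xs; elim: s inj xs => //= y s IH inj.
rewrite inE eq_sym => /predU1P[->|xs]; first by rewrite !eqxx.
have -> : (f y == f x) = (y == x).
  by apply/eqP/eqP => [/inj->|->] //; rewrite inE ?eqxx ?xs ?orbT.
rewrite IH // => u w us ws; apply: inj; by rewrite inE ?us ?ws orbT.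
Qed.

(** Simplification only sees which positions carry equal terms, and an injective renaming preserves
    this. *)
Lemma simple_atom_map (T U : eqType) (f : T -> U) (a : atom S T) :
  {in atom_args a &, injective f} ->
  simple_atom (map_atom f a) = map_atom f (simple_atom a).
Proof.
move=> inj; apply: atom_eq; last exact: unique_map_in.
congr Tagged; apply: eq_from_tnth => i; rewrite !tnth_map.
rewrite /= unique_map_in // index_map_in ?mem_unique ?mem_tnth //.
by move=> x y; rewrite !mem_unique; apply: inj.
Qed.

(** The simplified predicate records the original predicate and the equality type, which determine
    an atom up to injective renaming. *)
Lemma simple_pred_eq (a b : atom S var) :
  atom_pred (simple_atom a) = atom_pred (simple_atom b) ->
  exists2 f, b = map_atom f a & {in atom_args a &, injective f}.
Proof.
case: a b => [R s] [R' t] eqp; have eqR : R = R' := congr1 tag eqp.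
case: R' / eqR t eqp => t eqp.
have {eqp} : id_tuple s = id_tuple t := eq_from_Tagged eqp.
have lt_id (u : (arity R).-tuple var) i : (index (tnth u i) (unique u)).+1 < (arity R).+1.
  rewrite ltnS -[ltnRHS](size_tuple u); apply: leq_trans (size_unique u).
  by rewrite index_mem mem_unique mem_tnth.
move=> eqid; have {}eqid i : index (tnth s i) (unique s) = index (tnth t i) (unique t).
  have /(congr1 (fun u => val (tnth u i))) := eqid.
  by rewrite !tnth_map /= !inordK ?lt_id // => -[].
(* The renaming matches terms at equal positions of the two [unique] lists; on entries of [s] the
   default [0] is never reached. *)
pose f x := nth 0 (unique t) (index x (unique s)).
have fE i : f (tnth s i) = tnth t i by rewrite /f eqid nth_index // mem_unique mem_tnth.
exists f; first by congr Tagged; apply: eq_from_tnth => i; rewrite tnth_map fE.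
move=> _ _ /tnthP[i ->] /tnthP[j ->]; rewrite !fE => tij.
have := eqid i; rewrite tij -eqid; apply: (index_inj 0).
  all: by rewrite mem_unique mem_tnth.
Qed.

Lemma mem_simple_atom (T : eqType) (a : atom S T) :
  (atom_args (simple_atom a) : seq T) =i atom_args a.
Proof. exact: mem_unique. Qed.

Lemma mem_map_atom (S' : schema) (T U : eqType) (f : T -> U) (a : atom S' T) y :
  reflect (exists2 x, x \in atom_args a & y = f x) (y \in atom_args (map_atom f a)).
Proof. exact: mapP. Qed.

(** * Specializations *)

Section Specialization.
Context (xs : seq var) (f : var -> var) (spec : specialization xs f).

Lemma specialization_nth i : i < size xs ->
  f (nth 0 xs i) \in xs /\ f (f (nth 0 xs i)) = f (nth 0 xs i).
Proof.
have [_ fP] := spec.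
elim/ltn_ind: i => i IH ixs; have := fP i ixs; rewrite inE => /predU1P[e|/mapP[y]].
  by rewrite !e mem_nth.
move=> /(nthP 0)[j]; rewrite size_take ixs => ji; rewrite nth_take // => <- ->.
exact: IH ji (ltn_trans ji ixs).
Qed.

Lemma specialization_mem x : x \in xs -> f x \in xs.
Proof. by move=> /(nthP 0)[i /specialization_nth[? _] <-]. Qed.

Lemma specialization_id x : x \notin xs -> f x = x.
Proof. by case: spec => + _; apply. Qed.

Lemma specialization_idem x : f (f x) = f x.
Proof.
case: (boolP (x \in xs)) => [/(nthP 0)[i /specialization_nth[_ ?] <-] //|].
by move=> xs_x; rewrite !(specialization_id xs_x).
Qed.

End Specialization.

(** Sending each variable of [xs] to the first one with the same value under [k] gives a
    specialization with the kernel of [k]. *)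
Lemma ex_specialization (xs : seq var) (k : var -> var) :
  exists2 f, specialization xs f & {in xs &, forall x y, f x = f y <-> k x = k y}.
Proof.
pose idx x := index (k x) (map k xs).
have idx_lt x : x \in xs -> idx x < size xs.
  by move=> xxs; rewrite -(size_map k) index_mem map_f.
have k_idx x : x \in xs -> k (nth 0 xs (idx x)) = k x.
  by move=> xxs; rewrite -(nth_map _ 0) ?idx_lt // nth_index // map_f.
pose f x := if x \in xs then nth 0 xs (idx x) else x.
have fk x : x \in xs -> k (f x) = k x by move=> xxs; rewrite /f xxs k_idx.
have f_eq x y : x \in xs -> y \in xs -> k x = k y -> f x = f y.
  by move=> xxs yxs kxy; rewrite /f xxs yxs /idx kxy.
exists f; last first.
  by move=> x y xxs yxs; split => [fxy|]; [rewrite -fk // fxy fk | exact: f_eq].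
split=> [y /negPf yxs|i ixs]; first by rewrite /f yxs.
have xxs := mem_nth 0 ixs; set x := nth 0 xs i in xxs *.
have jlt := idx_lt _ xxs; have fxE : f x = nth 0 xs (idx x) by rewrite /f xxs.
have : idx x <= i by rewrite /idx -(nth_map _ (k 0)) // index_nth ?size_map.
rewrite leq_eqVlt => /predU1P[e|lt]; first by rewrite fxE e inE eqxx.
rewrite inE; apply/orP; right; apply/mapP; exists (nth 0 xs (idx x)).
  by rewrite -(nth_take 0 lt) mem_nth // size_take ixs.
by apply/esym/f_eq => //; [rewrite mem_nth | exact: k_idx].
Qed.

(** * Simplified TGDs and similarity of terms and atoms *)

Lemma simple_conj_vars (f : var -> var) (A : {fset atom S var}) z :
  reflect (exists2 x, x \in vars A & z = f x) (z \in vars (simple_conj f A)).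
Proof.
apply: (iffP (varsP _ _)) => [[c /imfsetP[a /= aA ->]]|[x /varsP[a aA xa] ->]].
  rewrite mem_simple_atom => /mem_map_atom[x xa ->]; exists x => //.
  by apply/varsP; exists a.
exists (simple_atom (map_atom f a)); first exact: in_imfset.
by rewrite mem_simple_atom; apply/mem_map_atom; exists x.
Qed.

Lemma mem_body1 sigma (a : atom S var) x : body sigma = [fset a]%fset ->
  (x \in vars (body sigma)) = (x \in atom_args a).
Proof.
move=> ->; apply/varsP/idP => [[b]|xa]; first by rewrite inE => /eqP->.
by exists a; rewrite ?inE.
Qed.

(** [f] maps body variables to body variables and fixes all others, so it never merges an
    existential variable with a frontier variable. *)
Lemma frontier_simple_tgd sigma (a : atom S var) f z :
  body sigma = [fset a]%fset -> specialization (atom_args a) f ->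
  reflect (exists2 y, y \in frontier sigma & z = f y)
          (z \in frontier (simple_tgd f sigma)).
Proof.
move=> ba spec; rewrite inE; apply: (iffP andP).
  move=> [/simple_conj_vars[x xb ->] /simple_conj_vars[y yh fxy]].
  exists y => //; rewrite inE yh andbT; move: xb; rewrite !(mem_body1 _ ba) => xa.
  apply: contraPT fxy => ya; rewrite (specialization_id spec ya) => fxy.
  by rewrite -fxy (specialization_mem spec xa) in ya.
move=> [y]; rewrite inE => /andP[yb yh] ->.
by split; apply/simple_conj_vars; exists y.
Qed.

(* Different specializations may give several counterparts to one null, and
   different TGDs may have equal simplifications, so neither side is a function
   of the other. *)
Inductive sim : term S -> term (simple_schema S) -> Prop :=
| sim_const c : sim (Const c) (Const c)
| sim_null x sigma f (h : {ffun frontier sigma -> term S})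
    (g : {ffun frontier (simple_tgd f sigma) -> term (simple_schema S)})
  of (forall y : frontier sigma, exists z : frontier (simple_tgd f sigma), val z = f (val y))
  & (forall z : frontier (simple_tgd f sigma), exists y : frontier sigma, val z = f (val y))
  & (forall y z, val z = f (val y) -> sim (h y) (g z)) :
  sim (Null x sigma h) (Null x (simple_tgd f sigma) g).

(** Every argument of either null has a partner of equal depth on the other side, so the maxima
    agree. *)
Lemma sim_depth t s : sim t s -> depth t = depth s.
Proof.
elim=> {t s} //= x sigma f h g hyz hzy _ IH; congr _.+1; apply/eqP; rewrite eqn_leq.
apply/andP; split; apply/bigmax_leqP.
  move=> y _; have [z zE] := hyz y; rewrite (IH _ _ zE).
  exact: (@leq_bigmax _ (fun z => depth (g z))).
move=> z _; have [y zE] := hzy z; rewrite -(IH _ _ zE).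
exact: (@leq_bigmax _ (fun y => depth (h y))).
Qed.

(** The common pattern [v] has the equality type of [b] because [alpha] is injective; [beta] need
    only be similar to [alpha] pointwise. *)
Definition sim_atom (b : atom S (term S))
    (c : atom (simple_schema S) (term (simple_schema S))) : Prop :=
  exists (v : atom S var) alpha beta,
    [/\ {in atom_args v &, injective alpha}, b = map_atom alpha v,
        c = map_atom beta (simple_atom v)
      & {in atom_args v, forall x, sim (alpha x) (beta x)}].

Lemma sim_result sigma a f h g d :
  body sigma = [fset a]%fset -> specialization (atom_args a) f ->
  {in atom_args a &, forall x y, h x = h y <-> f x = f y} ->
  {in atom_args a, forall x, sim (h x) (g (f x))} ->
  d \in head sigma ->
  sim_atom (map_atom (result_subst sigma h) d)
    (map_atom (result_subst (simple_tgd f sigma) g) (simple_atom (map_atom f d))).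
Proof.
move=> ba spec hf hg dh.
have frP z := frontier_simple_tgd z ba spec.
have fra y : y \in frontier sigma -> y \in atom_args a.
  by rewrite inE (mem_body1 _ ba) => /andP[].
have Nfra y : y \in atom_args d -> y \notin frontier sigma -> y \notin atom_args a.
  move=> yd; rewrite inE (mem_body1 _ ba) => /nandP[//|/negP[]].
  by apply/varsP; exists d.
have hfE y : y \in atom_args a -> h (f y) = h y.
  move=> ya; apply/hf; rewrite ?(specialization_idem spec) //.
  exact: (specialization_mem spec ya).
pose null y := Null y sigma [ffun y => h (val y)].
(* The test is membership in the body, since the representative [f y] of a frontier variable [y] may
   lie outside the frontier of [sigma]. *)
pose alpha y := if y \in atom_args a then h y else null y.
have alpha_in y : y \in frontier sigma -> alpha (f y) = h y.
  by move=> /fra ya; rewrite /alpha (specialization_mem spec ya) hfE.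
have alphaN y : y \notin atom_args a -> alpha (f y) = null y.
  by move=> ya; rewrite (specialization_id spec ya) /alpha (negPf ya).
(* [h x] is an argument of the null, hence of smaller depth. *)
have h_null x y : x \in frontier sigma -> h x <> null y.
  move=> xf e; have := depth_frontier y [ffun y : frontier sigma => h (val y)] [` xf]%fset.
  by rewrite ffunE /= e /= ltnn.
exists (map_atom f d), alpha, (result_subst (simple_tgd f sigma) g); split => //.
- move=> _ _ /mem_map_atom[x xd ->] /mem_map_atom[y yd ->].
  case: (boolP (x \in frontier sigma)) => xf; case: (boolP (y \in frontier sigma)) => yf.
  + by rewrite !alpha_in // => /hf; apply; apply: fra.
  + by rewrite alpha_in // alphaN ?Nfra // => /(h_null _ _ xf).
  + by rewrite alphaN ?Nfra // alpha_in // => /esym/(h_null _ _ yf).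
  + by rewrite !alphaN ?Nfra // => -[->].
- rewrite map_atom_comp; apply: eq_map_atom => y yd /=; rewrite /result_subst.
  by case: ifPn => yf; [rewrite alpha_in | rewrite alphaN ?Nfra].
- move=> _ /mem_map_atom[y yd ->]; rewrite /result_subst.
  case: (boolP (y \in frontier sigma)) => yf.
    rewrite alpha_in //; have -> : f y \in frontier (simple_tgd f sigma).
      by apply/frP; exists y.
    exact/hg/fra.
  have ya := Nfra y yd yf; rewrite alphaN // (specialization_id spec ya).
  (* The frontier of the simplified TGD consists of body variables, so an existential [y] is not in
     it. *)
  case: ifP => [/frP[x /fra/(specialization_mem spec) + yx]|_].
    by rewrite -yx (negPf ya).
  constructor.
  + move=> x; have xf : f (val x) \in frontier (simple_tgd f sigma).
      by apply/frP; exists (val x) => //; apply: valP.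
    by exists [` xf]%fset.
  + by move=> z; have /frP[x xf zx] := valP z; exists [` xf]%fset.
  + by move=> x z zx; rewrite !ffunE zx; apply/hg/fra/valP.
Qed.

(** * Transfer of derivations in both directions *)

Implicit Types (D : database S) (Sigma : set (tgd S)).

Lemma linear_body sigma : linear sigma -> exists a : atom S var, body sigma = [fset a]%fset.
Proof. by move=> /eqP/cardfs1P. Qed.

Lemma simple_body sigma (a : atom S var) f : body sigma = [fset a]%fset ->
  body (simple_tgd f sigma) = [fset simple_atom (map_atom f a)]%fset.
Proof.
move=> /= ->; apply/fsetP => c; rewrite in_fset1; apply/imfsetP/eqP => [[b /=]|->].
  by rewrite in_fset1 => /eqP->.
by exists a; rewrite //= in_fset1.
Qed.

Lemma sim_atom_db (a : atom S const) :
  sim_atom (map_atom Const a) (map_atom Const (simple_atom a)).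
Proof. by exists a, Const, Const; split => // [x y _ _ []|x _] //; constructor. Qed.

(** With [v] the pattern of the body image, [h] factors on the body as [alpha] after some [k]. The
    specialization with the kernel of [k] makes [beta \o k] a trigger on the simplified side. *)
Lemma derived_simple D Sigma b : (forall sigma, Sigma sigma -> linear sigma) ->
  derived D Sigma b ->
  exists2 c, derived (simple_db D) (simple_set Sigma) c & sim_atom b c.
Proof.
move=> lin; elim=> {b} [a aD|sigma h d Ss _ IH dh].
  exists (map_atom Const (simple_atom a)); last exact: sim_atom_db.
  by constructor; apply: in_imfset.
have [a ba] := linear_body (lin _ Ss).
have [|c0 cD [v [alpha [beta [inj bE cE simv]]]]] := IH a; first by rewrite ba in_fset1.
have [k vE hE] : exists2 k, v = map_atom k a & {in atom_args a, forall x, h x = alpha (k x)}.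
  case: a ba bE {IH} => [R xs] /= _; case: v inj cE simv => [R' vs] inj _ _ bE.
  have eqR : R = R' := congr1 tag bE; case: R' / eqR vs inj bE => vs inj bE.
  have {}bE : map_tuple h xs = map_tuple alpha vs := eq_from_Tagged bE.
  have {}bE i : h (tnth xs i) = alpha (tnth vs i).
    by have := congr1 (fun t => tnth t i) bE; rewrite !tnth_map.
  (* [k] reads [vs] at the first occurrence of [x]; at later occurrences injectivity of [alpha]
     forces the same entry. *)
  pose k x := nth 0 vs (index x xs).
  have kE i : k (tnth xs i) = tnth vs i.
    have ltj : index (tnth xs i) xs < arity R.
      by rewrite -[ltnRHS](size_tuple xs) index_mem mem_tnth.
    apply: inj; rewrite ?mem_tnth //; first by rewrite /k mem_nth // size_tuple.
    rewrite /k -[index _ _]/(val (Ordinal ltj)) -tnth_nth -!bE; congr h.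
    by rewrite (tnth_nth 0) nth_index // mem_tnth.
  exists k; first by congr Tagged; apply: eq_from_tnth => i; rewrite tnth_map kE.
  by move=> _ /tnthP[i ->]; rewrite kE bE.
have [f spec fk] := ex_specialization (atom_args a) k.
have kf x : x \in atom_args a -> k (f x) = k x.
  move=> xa; apply/fk; rewrite ?(specialization_idem spec) //.
  exact: (specialization_mem spec xa).
have kv x : x \in atom_args a -> k x \in atom_args v.
  by move=> xa; rewrite vE; apply/mem_map_atom; exists x.
(* [k] is injective on the representatives chosen by [f], so it commutes with simplification. *)
have simpE : simple_atom v = map_atom k (simple_atom (map_atom f a)).
  rewrite -simple_atom_map.
    by congr simple_atom; rewrite vE map_atom_comp; apply: eq_map_atom => x /kf.
  move=> _ _ /mem_map_atom[x xa ->] /mem_map_atom[y ya ->].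
  by rewrite !kf // => /fk; apply.
pose g := beta \o k.
exists (map_atom (result_subst (simple_tgd f sigma) g) (simple_atom (map_atom f d))).
  apply: derived_result; last exact: in_imfset.
    by exists sigma => //; exists a, f.
  move=> c; rewrite (simple_body _ ba) in_fset1 => /eqP->.
  by rewrite -map_atom_comp -simpE -cE.
apply: (sim_result ba spec) => // [x y xa ya|x xa]; last first.
  by rewrite hE // /g /= kf //; apply/simv/kv.
rewrite !hE //; split => [/inj e|/fk -> //].
by apply/fk => //; apply: e; apply: kv.
Qed.

(** Equal simplified predicates make the pattern [v] an injective renaming [k] of the specialized
    body atom, so [alpha] after [k] after [f] is a trigger for the original TGD. *)
Lemma simple_derived D Sigma c : (forall sigma, Sigma sigma -> linear sigma) ->
  derived (simple_db D) (simple_set Sigma) c ->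
  exists2 b, derived D Sigma b & sim_atom b c.
Proof.
move=> lin; elim=> {c} [c /imfsetP[a /= aD ->]|tau g c [sigma Ss [a [f [ba spec ->]]]] _ IH].
  exists (map_atom Const a); last exact: sim_atom_db.
  by constructor.
move=> /imfsetP[d /= dh ->].
have [|b0 bD [v [alpha [beta [inj bE cE simv]]]]] := IH (simple_atom (map_atom f a)).
  by rewrite (simple_body _ ba) in_fset1.
have /simple_pred_eq[k vE kinj] :
  atom_pred (simple_atom (map_atom f a)) = atom_pred (simple_atom v) := congr1 tag cE.
have gE : {in atom_args (map_atom f a), forall x, g x = beta (k x)}.
  set w := simple_atom (map_atom f a) in cE *.
  have gw : map_atom g w = map_atom (beta \o k) w.
    by rewrite cE vE simple_atom_map // map_atom_comp.
  have eqg := map_atom_eq_in gw.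
  by move=> x xfa; apply: eqg; rewrite mem_simple_atom.
have fa x : x \in atom_args a -> f x \in atom_args (map_atom f a).
  by move=> xa; apply/mem_map_atom; exists x.
have kv x : x \in atom_args a -> k (f x) \in atom_args v.
  by move=> /fa fxa; rewrite vE; apply/mem_map_atom; exists (f x).
pose h x := alpha (k (f x)).
have ha : map_atom h a = map_atom (alpha \o k) (map_atom f a).
  by rewrite map_atom_comp.
exists (map_atom (result_subst sigma h) d).
  apply: derived_result => // a'; rewrite ba in_fset1 => /eqP->.
  by rewrite ha -map_atom_comp -vE -bE.
apply: (sim_result ba spec) => // [x y xa ya|x xa]; last first.
  by rewrite gE ?fa //; apply/simv/kv.
split=> [/inj e|fxy]; last by rewrite /h fxy.
by apply: kinj; rewrite ?fa //; apply: e; apply: kv.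
Qed.

(** The terms of similar atoms are the images of the same pattern variables, pairwise of equal
    depth. *)
Lemma sim_dom_depth (I : instance S) (J : instance (simple_schema S)) :
  (forall b, I b -> exists2 c, J c & sim_atom b c) ->
  (forall c, J c -> exists2 b, I b & sim_atom b c) ->
  @depth S @` dom I = @depth (simple_schema S) @` dom J.
Proof.
move=> IJ JI; apply/seteqP; split => d [_ [b Ib [i ->]] <-].
  have [c Jc [v [alpha [beta [inj bE cE simv]]]]] := IJ b Ib.
  have [x xv e] : exists2 x, x \in atom_args v & tnth (atom_args b) i = alpha x.
    rewrite {}bE in i *; rewrite tnth_map; eexists; last by []; exact: mem_tnth.
  rewrite e (sim_depth (simv x xv)); exists (beta x) => //; exists c => //.
  have /tnthP[j xj] : x \in atom_args (simple_atom v) by rewrite mem_simple_atom.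
  by rewrite cE; exists j; rewrite tnth_map -xj.
have [c Jc [v [alpha [beta [inj bE cE simv]]]]] := JI b Ib.
have [x xv e] : exists2 x, x \in atom_args v & tnth (atom_args b) i = beta x.
  rewrite {}cE in i *; rewrite tnth_map; eexists; last by [].
  by rewrite -mem_simple_atom mem_tnth.
rewrite e -(sim_depth (simv x xv)); exists (alpha x) => //; exists c => //.
have /tnthP[j xj] := xv.
by rewrite bE; exists j; rewrite tnth_map -xj.
Qed.

(** A specialization is determined by its restriction to the finitely many body variables, which it
    maps among themselves. *)
Lemma finite_simple_set Sigma : finite_set Sigma -> finite_set (simple_set Sigma).
Proof.
move=> finS; apply: bigcup_finite => // sigma _.
pose V := vars (body sigma).
pose ext (k : {ffun V -> var}) x := if insub x is Some y then k y else x.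
have : finite_set [set simple_tgd (ext k) sigma | k in
    [set k : {ffun V -> var} | forall y, [set` V] (k y)]].
  exact/finite_image/finite_ffun/finite_fset.
apply: sub_finite_set => _ [a [f [ba spec ->]]].
exists [ffun y : V => f (val y)] => [y|].
  rewrite ffunE /= (mem_body1 _ ba) (specialization_mem spec) //.
  by rewrite -(mem_body1 _ ba); apply: (valP y).
congr simple_tgd; apply: funext => x; rewrite /ext.
case: insubP => [y _ <-|]; first by rewrite ffunE.
by rewrite (mem_body1 _ ba) => /(specialization_id spec).
Qed.

End Simplification.

Theorem proposition7p3 (S : schema) (D : database S) (Sigma : set (tgd S))
    (finSigma : finite_set Sigma)
    (linSigma : forall sigma, Sigma sigma -> linear sigma) :
  (CT D Sigma <-> CT (simple_db D) (simple_set Sigma)) /\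
  maxdepth D Sigma = maxdepth (simple_db D) (simple_set Sigma).
Proof.
have finSimple := finite_simple_set finSigma.
have depthE : @depth S @` dom (derived D Sigma) =
    @depth _ @` dom (derived (simple_db D) (simple_set Sigma)).
  by apply: sim_dom_depth => a; [exact: derived_simple | exact: simple_derived].
(* Both sides say that one and the same set of depths is bounded. *)
have finE : finite_set (derived D Sigma) <->
    finite_set (derived (simple_db D) (simple_set Sigma)).
  by rewrite !finite_derivedP // depthE.
rewrite /CT /maxdepth /= !chaseE // depthE; split => //.
by congr (if _ then _ else _); apply/asbool_equiv_eq.
Qed.
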